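(* The function $\lfloor\log_m(n)\rfloor$ (for integer arguments $m\ge2$ and $n\ge1$) can be represented by the arithmetic term $$\mathrm{HW}(M(m,n))/(2mn)-(n+1)^2-1,$$ i.e. $\lfloor\log_m(n)\rfloor$ equals this expression for all integers $m\ge2$, $n\ge1$, where $$\begin{aligned}M(m,n)={}&\mathcal C(n^2,2)+\mathcal A(2x_1m^{x_2},2)+\mathcal A(-2nm^{x_2},2)+\mathcal A(m^{2x_2},2)\\&+\mathcal A(-2nx_1,2)+\mathcal A(x_1^2,2),\end{aligned}$$ with $\mathcal C$ and $\mathcal A$ formed with the parameters $t=n+1$ and $w=2mn$.
   Context: $\mathrm{HW}(N)$ is the Hamming weight of $N$ (number of ones in its binary representation). $G_r(q,s)=\sum_{j=0}^{s}j^rq^j$ with $0^0=1$; for each fixed $r$ this has a closed form. Given parameters $t>1$, $w$ (depending on the arguments) and $k\ge1$: $$\mathcal C(\varepsilon,k)=(2^w-\varepsilon+1)\,\frac{2^{2wt^k}-1}{2^w+1},$$ and for a monomial $\mu=\alpha\, b_1^{\beta_1x_1}\cdots b_k^{\beta_kx_k}x_1^{\gamma_1}\cdots x_k^{\gamma_k}$ in the formal variables $x_1,\dots,x_k$ (with $\alpha$ an integer possibly negative, and absent exponential factors meaning $\beta_i=0$, absent powers meaning $\gamma_i=0$), $$\mathcal A(\mu,k)=-(2^w-1)\,\alpha\prod_{i=1}^kG_{\gamma_i}\!\left(2^{2wt^{i-1}}b_i^{\beta_i},\,t-1\right).$$ An arithmetic term is an expression built from natural-number constants and the variables by the operations $x+y$,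 $\max(x-y,0)$, $\lfloor x/y\rfloor$, $x^y$ (with $0^0=1$, $\lfloor x/0\rfloor=0$). Products, $\mathrm{HW}$ and $G_r$ (fixed $r$) are expressible by arithmetic terms and are used as abbreviations; formulas are written with ordinary subtraction and exact division for readability. *)

(* Defs.v *)
From mathcomp Require Import all_boot all_order all_algebra.

Set Implicit Arguments.
Unset Strict Implicit.
Unset Printing Implicit Defensive.

Import Order.TTheory GRing.Theory Num.Theory.

(* Arithmetic terms in k variables.  The natural-number operations [subn],
   [divn] and [expn] already satisfy x - y = max(x - y, 0), x %/ 0 = 0 and
   0 ^ 0 = 1. *)
Inductive aterm (k : nat) : Type :=
  | ACst of nat
  | AVar of 'I_k
  | AAdd of aterm k & aterm k
  | ASub of aterm k & aterm k
  | ADiv of aterm k & aterm k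
  | AExp of aterm k & aterm k.

Fixpoint aeval (k : nat) (v : k.-tuple nat) (a : aterm k) : nat :=
  match a with
  | ACst c => c
  | AVar i => tnth v i
  | AAdd a1 a2 => aeval v a1 + aeval v a2
  | ASub a1 a2 => aeval v a1 - aeval v a2
  | ADiv a1 a2 => aeval v a1 %/ aeval v a2
  | AExp a1 a2 => aeval v a1 ^ aeval v a2
  end.

(* N < 2 ^ N, so the bits of index at least N all vanish. *)
Definition hw (N : nat) : nat := \sum_(i < N) (N %/ 2 ^ i) %% 2.

Definition G (r q s : nat) : nat := \sum_(0 <= j < s.+1) j ^ r * q ^ j.

(* The formal monomial
     mcoef * \prod_i mbase_i ^ (mexp_i * x_i) * \prod_i x_i ^ mpow_i
   in x_1, ..., x_k; x_i is stored at index i - 1. *)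
Record monomial (k : nat) : Type := Monomial {
  mcoef : int;
  mbase : k.-tuple nat;
  mexp  : k.-tuple nat;
  mpow  : k.-tuple nat }.

Local Open Scope ring_scope.

(* Values are taken in [rat], where subtraction and division are the ordinary
   ones rather than truncated. *)
Definition calC (t w : nat) (eps : int) (k : nat) : rat :=
  (2 ^+ w - eps%:~R + 1) * ((2 ^+ (2 * w * t ^ k)%N - 1) / (2 ^+ w + 1)).

(* The index i : 'I_k starts at 0, hence t ^ i for the exponent t^(i-1). *)
Definition calA (t w : nat) (k : nat) (mu : monomial k) : rat :=
  - (2 ^+ w - 1) * (mcoef mu)%:~R *
  \prod_(i < k)
    (G (tnth (mpow mu) i)
       (2 ^ (2 * w * t ^ i) * tnth (mbase mu) i ^ tnth (mexp mu) i)
       t.-1)%:R.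

(* Where the exponential factor in x_i is absent (mexp_i = 0), the base is
   irrelevant and set to 1. *)
Definition M (m n : nat) : rat :=
  let t := (n + 1)%N in
  let w := (2 * m * n)%N in
  calC t w (n ^ 2)%:Z 2
  (* 2 x_1 m^x_2 *)
  + calA t w (Monomial 2 [tuple 1; m]%N [tuple 0; 1]%N [tuple 1; 0]%N)
  (* -2 n m^x_2 *)
  + calA t w (Monomial (- (2 * n)%:Z) [tuple 1; m]%N [tuple 0; 1]%N
                [tuple 0; 0]%N)
  (* m^(2 x_2) *)
  + calA t w (Monomial 1 [tuple 1; m]%N [tuple 0; 2]%N [tuple 0; 0]%N)
  (* -2 n x_1 *)
  + calA t w (Monomial (- (2 * n)%:Z) [tuple 1; 1]%N [tuple 0; 0]%N
                [tuple 1; 0]%N)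
  (* x_1^2 *)
  + calA t w (Monomial 1 [tuple 1; 1]%N [tuple 0; 0]%N [tuple 2; 0]%N).

(* Main.v *)
Require Import Defs.
From mathcomp Require Import all_boot all_order all_algebra.
From mathcomp Require Import zify ring.

Set Implicit Arguments.
Unset Strict Implicit.
Unset Printing Implicit Defensive.

Import Order.TTheory GRing.Theory Num.Theory.

(** Put t = n + 1, w = 2mn, and let f(x, y) = (m^y + x - n)^2.  The
    constant term n^2 of f enters M through C(n^2, 2) and its other five monomials
    through A, so expanding the sums G_r shows that M is the number whose digit of
    index x + t y in base 2^(2w), for 0 <= x, y <= n, is
        (2^w - 1) (2^w + 1 - f(x, y)).
    If f(x, y) = 0 this digit is 2^(2w) - 1, with 2w ones.  Otherwise
    1 <= f(x, y) <= 2^w, the digit is (2^w - 1) c with 1 <= c <= 2^w, and it has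
    exactly w ones: (2^w - 1) c = 2^w (c - 1) + (2^w - 1 - (c - 1)), and the two
    halves are complementary w-bit words ([hw_mul_mersenne]).  Hence
        HW(M) = w (t^2 + #{(x, y) | f(x, y) = 0}),
    and f vanishes exactly when m^y <= n and x = n - m^y, that is for
    floor(log_m n) + 1 pairs ([hw_blocksum]).  The bound f <= 2^w holds as
    |m^y + x - n| <= m^n and m^(2n) <= 2^(2mn).

    That the right-hand side is an arithmetic term is proved by closure lemmas
    for the functions [arith D] computed on D by some term.  Products come from
    squares.  Binomial coefficients and gcds rest on one device, [digit_extract]:
    if the coefficients of a polynomial P are natural numbers with sum less than
    B, then the coefficient of degree k is the digit of index k of P(B) in base B,
    obtained with one quotient and one remainder. Binomial coefficients are
    the coefficients of (B + 1)^n. The gcd of a and b is the coefficient of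
    degree a b in a product of two geometric sums. Legendre's formula gives
    HW(N) as the 2-adic valuation of 'C(2N, N) ([hw_logn]); the gcd of that
    binomial with a power of two isolates 2^HW(N), and the exponent k of p =
    2^k is read off from (1 + Y)^k = 1 + kY modulo Y^2 ([log_pow2]). Finally
    the sums G_r satisfy a recursion on r ([G_closed]). *)

(** * The Hamming weight of numbers written by blocks of bits *)

(** The number of bits inspected is immaterial once they cover N; sums over
    different ranges can thus be aligned. *)
Lemma hwE K N : N < 2 ^ K -> hw N = \sum_(i < K) (N %/ 2 ^ i) %% 2.
Proof.
have stable a b : N < 2 ^ a -> a <= b ->
    \sum_(i < b) (N %/ 2 ^ i) %% 2 = \sum_(i < a) (N %/ 2 ^ i) %% 2.
  move=> ltNa leab.
  rewrite -!(big_mkord xpredT (fun i => (N %/ 2 ^ i) %% 2)).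
  rewrite (big_cat_nat (leq0n a) leab) //= [X in _ + X]big_nat_cond.
  rewrite [X in _ + X]big1 ?addn0 // => i; rewrite andbT => /andP[leai _].
  by rewrite divn_small ?mod0n // (leq_trans ltNa) // leq_exp2l.
move=> ltNK; rewrite /hw.
have ltNN : N < 2 ^ N by apply: ltn_expl.
have [/(stable _ _ ltNN) //|/ltnW/(stable _ _ ltNK) //] := leqP N K.
Qed.

Lemma hw0 : hw 0 = 0.
Proof. by rewrite /hw big_ord0. Qed.

Lemma hw_halve N : hw N = N %% 2 + hw (N %/ 2).
Proof.
have ltN : N %/ 2 < 2 ^ N.
  by apply: leq_ltn_trans (leq_div _ _) (ltn_expl _ _).
rewrite (hwE ltN) (@hwE N.+1); last by rewrite ltnW // ltn_expl.
rewrite big_ord_recl divn1; congr (_ + _); apply: eq_bigr => i _.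
by rewrite -divnMA expnS.
Qed.

Lemma hw_cat L a b : a < 2 ^ L -> hw (a + 2 ^ L * b) = hw a + hw b.
Proof.
elim: L a => [|L IH] a.
  by rewrite expn0 ltnS leqn0 => /eqP->; rewrite hw0 mul1n.
move=> lta; rewrite hw_halve [in RHS]hw_halve -addnA -IH; last first.
  by rewrite ltn_divLR // mulnC -expnS.
have -> : a + 2 ^ L.+1 * b = (2 ^ L * b) * 2 + a by rewrite expnS; lia.
by rewrite modnMDl divnMDl // [_ + a %/ 2]addnC.
Qed.

(** The complement of an L-bit word exchanges its zeros and its ones. *)
Lemma hw_compl L a : a < 2 ^ L -> hw (2 ^ L - 1 - a) + hw a = L.
Proof.
elim: L a => [|L IH] a.
  by rewrite expn0 ltnS leqn0 => /eqP->; rewrite hw0.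
move=> lta; have lta2 : a %/ 2 < 2 ^ L by rewrite ltn_divLR // mulnC -expnS.
have bit : a %% 2 <= 1 by rewrite -ltnS ltn_mod.
have eqa : a = a %/ 2 * 2 + a %% 2 := divn_eq a 2.
have -> : 2 ^ L.+1 - 1 - a = (2 ^ L - 1 - a %/ 2) * 2 + (1 - a %% 2).
  by rewrite expnS; lia.
rewrite hw_halve modnMDl divnMDl // [(1 - _) %/ 2]divn_small ?addn0; last by lia.
rewrite modn_small; last by lia.
by rewrite [hw a]hw_halve; have := IH _ lta2; lia.
Qed.

Lemma hw_mersenne L : hw (2 ^ L - 1) = L.
Proof. by rewrite -[RHS](@hw_compl L 0) ?expn_gt0 // subn0 hw0 addn0. Qed.

(** Since (2^w - 1) c = 2^w (c - 1) + (2^w - 1 - (c - 1)), the upper and the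
    lower half are complementary w-bit words, so that the weight does not depend
    on c. *)
Lemma hw_mul_mersenne w c : 0 < c <= 2 ^ w -> hw ((2 ^ w - 1) * c) = w.
Proof.
case: c => // c /= ltc.
have -> : (2 ^ w - 1) * c.+1 = (2 ^ w - 1 - c) + 2 ^ w * c.
  by case: (2 ^ w) ltc => // P; rewrite subn1 mulnS mulSn /=; lia.
by rewrite hw_cat ?hw_compl //; lia.
Qed.

Lemma numeral_lt L J (d : nat -> nat) : (forall j, j < J -> d j < 2 ^ L) ->
  \sum_(j < J) d j * 2 ^ (L * j) < 2 ^ (L * J).
Proof.
elim: J => [|J IH] ltd; first by rewrite big_ord0 muln0.
rewrite big_ord_recr /= mulnS expnD.
have lo := IH (fun j ltj => ltd j (ltnW ltj)).
have := leq_mul (ltd J (ltnSn J)) (leqnn (2 ^ (L * J))).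
by rewrite mulSn; apply: leq_trans; rewrite ltn_add2r.
Qed.

Lemma hw_numeral L J (d : nat -> nat) : (forall j, j < J -> d j < 2 ^ L) ->
  hw (\sum_(j < J) d j * 2 ^ (L * j)) = \sum_(j < J) hw (d j).
Proof.
elim: J => [|J IH] ltd; first by rewrite !big_ord0 hw0.
have ltd' j : j < J -> d j < 2 ^ L by move=> /ltnW; apply: ltd.
by rewrite !big_ord_recr /= mulnC hw_cat ?numeral_lt // IH.
Qed.

(** * Coefficients of polynomials as digits *)

(** The terms of exponent less than k add up to less than B^k, and those of
    exponent greater than k are multiples of B^(k+1): the quotient removes the
    former, the remainder the latter. *)
Lemma digit_extract (I : finType) (c e : I -> nat) B k :
    \sum_i c i < B ->
  (\sum_i c i * B ^ e i) %/ B ^ k %% B = \sum_(i | e i == k) c i.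
Proof.
move=> ltB; have B_gt0 : 0 < B := leq_ltn_trans (leq0n _) ltB.
have Bk : 0 < B ^ k by rewrite expn_gt0 B_gt0.
rewrite (bigID (fun i => e i < k)) /=.
rewrite (bigID (fun i => e i == k) (fun i => ~~ _)) /=.
set lo := \sum_(i | _) _.
have lt_lo : lo < B ^ k.
  have [i0 lti0|none] := pickP (fun i => e i < k); last first.
    by rewrite /lo big_pred0.
  have k_gt0 : 0 < k := leq_ltn_trans (leq0n _) lti0.
  rewrite -(prednK k_gt0) expnS.
  apply: leq_ltn_trans (_ : _ <= (\sum_i c i) * B ^ k.-1) _.
    rewrite big_distrl /= [X in _ <= X](bigID (fun i => e i < k)) /=.
    apply: leq_trans (leq_addr _ _); apply: leq_sum => i lti.
    by rewrite leq_mul2l leq_pexp2l ?orbT // -ltnS prednK.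
  by rewrite ltn_pmul2r // expn_gt0 B_gt0.
have -> : \sum_(i | ~~ (e i < k) && (e i == k)) c i * B ^ e i
    = (\sum_(i | e i == k) c i) * B ^ k.
  rewrite big_distrl /=; apply: eq_big => [i|i /andP[_ /eqP->] //].
  by rewrite -leqNgt; case: eqP => [->|]; rewrite ?leqnn ?andbF.
(* what remains is a multiple of B ^ k.+1 *)
have [q ->] : exists q,
    \sum_(i | ~~ (e i < k) && (e i != k)) c i * B ^ e i = (q * B) * B ^ k.
  exists (\sum_(i | ~~ (e i < k) && (e i != k)) c i * B ^ (e i - k.+1)).
  rewrite !big_distrl /=; apply: eq_bigr => i; rewrite -leqNgt => lti.
  by rewrite -!mulnA -expnS -expnD; congr (_ * B ^ _); lia.
rewrite addnC -mulnDl divnMDl // [lo %/ _]divn_small // addn0 addnC modnMDl.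
rewrite modn_small //; apply: leq_ltn_trans ltB.
by rewrite [X in _ <= X](bigID (fun i => e i == k)) leq_addr.
Qed.

(** The coefficients of (B + 1)^n have sum 2^n, so that B = 2^(n+1) is large
    enough. *)
Lemma bin_digit n k :
  (2 ^ n.+1 + 1) ^ n %/ (2 ^ n.+1) ^ k %% 2 ^ n.+1 = 'C(n, k).
Proof.
have sumC : \sum_(i < n.+1) 'C(n, i) = 2 ^ n.
  by rewrite -[2]/(1 + 1) expnDn; apply: eq_bigr => i _; rewrite !exp1n !muln1.
rewrite addnC expnDn.
under eq_bigr do rewrite exp1n mul1n.
rewrite (@digit_extract _ (fun i : 'I_n.+1 => 'C(n, i)) val) /=; last first.
  by rewrite sumC ltn_exp2l.
have [ltk|lekn] := ltnP n k.
  rewrite bin_small // big_pred0 // => i; apply/eqP => eik.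
  by have := ltn_ord i; lia.
rewrite -ltnS in lekn.
by rewrite (big_pred1 (Ordinal lekn)).
Qed.

Lemma geom_sum B n : 1 < B -> \sum_(i < n) B ^ i = (B ^ n - 1) %/ (B - 1).
Proof.
move=> ltB; suff -> : B ^ n - 1 = (\sum_(i < n) B ^ i) * (B - 1).
  by rewrite mulnK // subn_gt0.
elim: n => [|n IH]; first by rewrite big_ord0.
rewrite big_ord_recr /= mulnDl -IH expnS.
have : 0 < B ^ n by rewrite expn_gt0; lia.
by nia.
Qed.

Lemma count_multiples d g : 0 < d -> \sum_(i < d * g) (d %| i.+1) = g.
Proof.
move=> d_gt0; rewrite -[RHS](mulKn g d_gt0) divn_count_dvd big_add1 /=.
by rewrite big_mkord.
Qed.

(** With g the gcd, b divides a i iff b / g divides i, and there are g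
    multiples of b / g between 1 and b. *)
Lemma gcd_count a b : 0 < b -> \sum_(i < b) (b %| a * i.+1) = gcdn a b.
Proof.
move=> b_gt0; have g_gt0 : 0 < gcdn a b by rewrite gcdn_gt0 b_gt0 orbT.
have [d def_b] := dvdnP (dvdn_gcdr a b).
have [c def_a] := dvdnP (dvdn_gcdl a b).
have d_gt0 : 0 < d by move: b_gt0; rewrite def_b muln_gt0 => /andP[].
have co_dc : coprime d c.
  by rewrite /coprime gcdnC -(eqn_pmul2r g_gt0) muln_gcdl -def_a -def_b mul1n.
rewrite -[RHS](count_multiples _ d_gt0) -def_b; apply: eq_bigr => i _.
set g := gcdn a b in g_gt0 def_a def_b *; move: (i.+1) => j.
by rewrite def_b def_a mulnAC dvdn_pmul2r // Gauss_dvdr.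
Qed.

(** In (z^a + z^(2a) + ... + z^(ba)) (1 + z^b + ... + z^((a-1)b)) the
    coefficient of z^(ab) counts the pairs 1 <= i <= b, 0 <= j < a such that
    a i + b j = a b.  For each i there is one such j if b divides a i, and none
    otherwise.  There are a b pairs in all, fewer than B. *)
Lemma gcd_digit a b (B := 2 ^ (a * b)) : 0 < a -> 0 < b ->
  (B ^ a * (((B ^ a) ^ b - 1) %/ (B ^ a - 1)) *
    (((B ^ b) ^ a - 1) %/ (B ^ b - 1))) %/ B ^ (a * b) %% B = gcdn a b.
Proof.
move=> a_gt0 b_gt0.
have ltB : a * b < B by apply: ltn_expl.
have B1 : 1 < B by rewrite -[1]/(2 ^ 0) ltn_exp2l // muln_gt0 a_gt0.
have Ba : 1 < B ^ a by rewrite -[1](exp1n a) ltn_exp2r.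
have Bb : 1 < B ^ b by rewrite -[1](exp1n b) ltn_exp2r.
pose e (p : 'I_b * 'I_a) := a + (a * p.1 + b * p.2).
have -> : B ^ a * (((B ^ a) ^ b - 1) %/ (B ^ a - 1)) *
    (((B ^ b) ^ a - 1) %/ (B ^ b - 1)) = \sum_p 1 * B ^ e p.
  rewrite -!geom_sum // -mulnA big_distrlr big_distrr /=.
  under eq_bigr do rewrite big_distrr /=.
  rewrite pair_bigA /=; apply: eq_bigr => p _.
  by rewrite mul1n -2!(expnM B) -2!expnD.
have -> := @digit_extract _ (fun=> 1) e B (a * b); last first.
  by rewrite sum1_card card_prod !card_ord mulnC.
rewrite -gcd_count // big_mkcond /=.
rewrite -(pair_bigA _ (fun i j => if e (i, j) == a * b then 1 else 0)) /=.
apply: eq_bigr => i _.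
rewrite -big_mkcond /= /e /=.
have [/dvdnP[q eq_q]|ndvd] := boolP (b %| a * i.+1); last first.
  rewrite big_pred0 // => j; apply: contraNF ndvd => /eqP eq_j.
  by rewrite mulnS -(dvdn_addl _ (dvdn_mulr j (dvdnn b))) -addnA eq_j dvdn_mull.
have le_qa : q <= a.
  by rewrite -(leq_pmul2r b_gt0) -eq_q leq_mul2l ltn_ord orbT.
have q_gt0 : 0 < q by move: (muln_gt0 a i.+1); rewrite eq_q a_gt0; case: (q).
have lt_j : a - q < a by lia.
rewrite (big_pred1 (Ordinal lt_j)) => [//|j].
rewrite /= -(inj_eq val_inj) /=.
rewrite addnA -mulnS eq_q [q * b]mulnC [a * b]mulnC -mulnDr eqn_pmul2l //.
by apply/eqP/eqP; lia.
Qed.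

(** * The Hamming weight as a logarithm *)

Lemma gcd_pow2 x : 0 < x -> gcdn x (2 ^ x) = 2 ^ logn 2 x.
Proof.
move=> x_gt0; have [u co2u def_x] := pfactor_coprime (isT : prime 2) x_gt0.
have le_vx : logn 2 x <= x by apply/ltnW/ltn_logl.
have -> : gcdn x (2 ^ x) =
    gcdn (u * 2 ^ logn 2 x) (2 ^ (x - logn 2 x) * 2 ^ logn 2 x).
  by rewrite -expnD subnK // -def_x.
rewrite -muln_gcdl; have /eqP-> : coprime u (2 ^ (x - logn 2 x)).
  by rewrite coprimeXr // coprime_sym.
by rewrite mul1n.
Qed.

(** By Legendre's formula the valuation is the sum over j of
    floor(2N / 2^(j+1)) - 2 floor(N / 2^(j+1)), whose term of index j is the j-th
    bit of N. *)
Lemma hw_logn N : hw N = logn 2 'C(N.*2, N).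
Proof.
have facE : 'C(N.*2, N) * (N`! * N`!) = (N.*2)`!.
  by rewrite -addnn -[in RHS](bin_fact (leq_addr N N)) addnK.
have logE : logn 2 'C(N.*2, N) + (logn 2 N`! + logn 2 N`!) = logn 2 (N.*2)`!.
  rewrite -facE !lognM ?muln_gt0 ?fact_gt0 // bin_gt0 -addnn leq_addr //.
have legendre K : logn 2 K`! = \sum_(i < K) K %/ 2 ^ i.+1.
  by rewrite logn_fact // big_add1 big_mkord.
(* the further terms of the longer sum are zero *)
have legendreW : logn 2 N`! = \sum_(i < N.*2) N %/ 2 ^ i.+1.
  rewrite legendre -!(big_mkord xpredT (fun i => N %/ 2 ^ i.+1)).
  rewrite (big_cat_nat (leq0n N) (_ : N <= N.*2)) /=; last first.
    by rewrite -addnn leq_addr.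
  rewrite [X in _ = _ + X]big_nat_cond [X in _ = _ + X]big1 ?addn0 // => i.
  rewrite andbT => /andP[leNi _]; rewrite divn_small //.
  by apply: leq_trans (ltn_expl N (isT : 1 < 2)) _; rewrite leq_exp2l // ltnW.
apply/eqP; rewrite -(eqn_add2r (logn 2 N`! + logn 2 N`!)) logE.
rewrite (legendre N.*2) legendreW.
rewrite (@hwE N.*2); last first.
  apply: leq_trans (ltn_expl N (isT : 1 < 2)) _.
  by rewrite leq_exp2l // -addnn leq_addr.
rewrite -!big_split /=; apply/eqP/eq_bigr => i _; move: (val i) => j.
rewrite expnS -mul2n divnMl // mulnC divnMA.
by have := divn_eq (N %/ 2 ^ j) 2; lia.
Qed.

(** Let Y = 2^(p+1) - 1.  Then p^(p+1) = (2^(p+1))^k = (1 + Y)^k is congruent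
    to 1 + kY modulo Y^2, and 1 + kY < Y^2 because k < p < Y. *)
Lemma log_pow2 k (p := 2 ^ k) (q := 2 ^ p.+1) :
  p ^ p.+1 %% (q - 1) ^ 2 %/ (q - 1) = k.
Proof.
have ltkp : k < p by apply: ltn_expl.
have ltpq : p.+1 < q by apply: ltn_expl.
have [Y def_q] : exists Y, q = Y.+1 by exists q.-1; rewrite prednK // expn_gt0.
rewrite /p -expnM mulnC expnM -/p -/q def_q subn1 /=.
have Y_gt1 : 1 < Y by lia.
have binom j : exists s, Y.+1 ^ j = s * Y ^ 2 + (j * Y + 1).
  elim: j => [|j [s IH]]; first by exists 0.
  by exists (s * Y.+1 + j); rewrite expnS IH; ring.
have [s ->] := binom k.
have ltkY : k < Y by lia.
rewrite modnMDl modn_small; last by nia.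
by rewrite divnMDl ?divn_small ?addn0 //; lia.
Qed.

(** * The sums G_r *)

(** Both sides are the sum of j^r q^j for 0 <= j <= s + 1.  On the left the terms
    with j > 0 come from expanding (j + 1)^r. *)
Lemma G_shift r q s :
  q * (\sum_(i < r.+1) 'C(r, i) * G i q s) + 0 ^ r
    = G r q s + s.+1 ^ r * q ^ s.+1.
Proof.
have -> : \sum_(i < r.+1) 'C(r, i) * G i q s =
    \sum_(0 <= j < s.+1) j.+1 ^ r * q ^ j.
  under [LHS]eq_bigr => i _ do rewrite /G big_distrr /=.
  rewrite exchange_big /=; apply: eq_bigr => j _.
  rewrite -[j.+1]add1n expnDn big_distrl /=; apply: eq_bigr => i _.
  by rewrite exp1n mul1n mulnA.
rewrite -[RHS](@big_nat_recr _ _ _ s.+1 0 (fun j => j ^ r * q ^ j)) //=.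
rewrite [RHS]big_nat_recl // muln1 addnC big_distrr /=; congr (_ + _).
by apply: eq_bigr => j _; rewrite expnS mulnCA.
Qed.

Lemma G_geometric q s : q * G 0 q s + 1 = G 0 q s + q ^ s.+1.
Proof. by have := G_shift 0 q s; rewrite big_ord1 bin0 !mul1n. Qed.

(** [G_shift] solved for its term of index r: an expression by the sums of lower
    order. *)
Lemma G_closed r q s : 1 < q ->
  G r q s = (s.+1 ^ r * q ^ s.+1
               - (q * (\sum_(i < r) 'C(r, i) * G i q s) + 0 ^ r))
              %/ (q - 1).
Proof.
move=> q_gt1; have := G_shift r q s.
rewrite big_ord_recr /= binn mul1n mulnDr => eqG.
set lower := q * _ in eqG *.
have -> : s.+1 ^ r * q ^ s.+1 - (lower + 0 ^ r) = G r q s * (q - 1).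
  by rewrite mulnBr muln1 [G r q s * q]mulnC; lia.
by rewrite mulnK // subn_gt0.
Qed.

(** * Functions computed by arithmetic terms *)

(** Agreement is required on D only: the closed form of G_r fails for q = 1, and
    the term for the gcd fails at 0. *)
Definition arith k (D : pred (k.-tuple nat)) (F : k.-tuple nat -> nat) :=
  exists tau : aterm k, forall v, D v -> aeval v tau = F v.

Section Arith.
Variables (k : nat) (D : pred (k.-tuple nat)).
Implicit Types F H : k.-tuple nat -> nat.
Local Notation arith := (arith D).

Lemma arith_ext F H : (forall v, D v -> F v = H v) -> arith H -> arith F.
Proof.
move=> eqFH [a aE]; exists a => v Dv.
by rewrite aE ?eqFH.
Qed.

Lemma arith_cst c : arith (fun=> c).
Proof. by exists (ACst k c). Qed.

Lemma arith_var i : arith (fun v => tnth v i).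
Proof. by exists (AVar i). Qed.

Lemma arith_add F H : arith F -> arith H -> arith (fun v => F v + H v).
Proof.
by move=> [a aE] [b bE]; exists (AAdd a b) => v Dv /=; rewrite aE ?bE.
Qed.

Lemma arith_succ F : arith F -> arith (fun v => (F v).+1).
Proof.
by move=> [a aE]; exists (AAdd a (ACst k 1)) => v Dv /=; rewrite aE ?addn1.
Qed.

Lemma arith_sub F H : arith F -> arith H -> arith (fun v => F v - H v).
Proof.
by move=> [a aE] [b bE]; exists (ASub a b) => v Dv /=; rewrite aE ?bE.
Qed.

Lemma arith_div F H : arith F -> arith H -> arith (fun v => F v %/ H v).
Proof.
by move=> [a aE] [b bE]; exists (ADiv a b) => v Dv /=; rewrite aE ?bE.
Qed.

Lemma arith_exp F H : arith F -> arith H -> arith (fun v => F v ^ H v).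
Proof.
by move=> [a aE] [b bE]; exists (AExp a b) => v Dv /=; rewrite aE ?bE.
Qed.

(** From the squares, by the polarization identity. *)
Lemma arith_mul F H : arith F -> arith H -> arith (fun v => F v * H v).
Proof.
move=> aF aH.
apply: (@arith_ext _ (fun v => ((F v + H v) ^ 2 - (F v ^ 2 + H v ^ 2)) %/ 2)).
  by move=> v _; rewrite sqrnD addKn mulKn.
do ![apply: arith_add | apply: arith_sub | apply: arith_div | apply: arith_exp
    | exact: aF | exact: aH | apply: arith_cst].
Qed.

Lemma arith_mod F H : arith F -> arith H -> arith (fun v => F v %% H v).
Proof.
move=> aF aH; apply: (@arith_ext _ (fun v => F v - F v %/ H v * H v)).
  by move=> v _; rewrite {2}(divn_eq (F v) (H v)) addKn.
by apply: arith_sub => //; apply: arith_mul => //; apply: arith_div.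
Qed.

Lemma arith_sum r (F : nat -> k.-tuple nat -> nat) :
  (forall i, i < r -> arith (F i)) -> arith (fun v => \sum_(i < r) F i v).
Proof.
elim: r => [|r IH] aF.
  apply: (@arith_ext _ (fun=> 0)); last exact: arith_cst.
  by move=> v _; rewrite big_ord0.
apply: (@arith_ext _ (fun v => (\sum_(i < r) F i v) + F r v)).
  by move=> v _; rewrite big_ord_recr.
by apply: arith_add; [apply: IH => i /ltnW; apply: aF | apply: aF].
Qed.

End Arith.

(** The leaves of an expression are closed by hypotheses or as constants, its
    nodes by the closure lemmas, read off from the head symbol. *)
Ltac arith_step := first
  [ assumption | apply: arith_cst | apply: arith_var | apply: arith_add
  | apply: arith_sub | apply: arith_mul | apply: arith_div | apply: arith_mod
  | apply: arith_exp ].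

Section ArithFunctions.
Variables (k : nat) (D : pred (k.-tuple nat)).
Implicit Types F H : k.-tuple nat -> nat.
Local Notation arith := (arith D).

Lemma arith_bin F H : arith F -> arith H -> arith (fun v => 'C(F v, H v)).
Proof.
move=> aF aH.
apply: (@arith_ext _ _ _ (fun v => (2 ^ (F v + 1) + 1) ^ F v
    %/ (2 ^ (F v + 1)) ^ H v %% 2 ^ (F v + 1))).
  by move=> v _; rewrite (addn1 (F v)) bin_digit.
by repeat arith_step.
Qed.

Lemma arith_gcd F H :
  (forall v, D v -> 0 < F v) -> (forall v, D v -> 0 < H v) ->
  arith F -> arith H -> arith (fun v => gcdn (F v) (H v)).
Proof.
move=> F_gt0 H_gt0 aF aH.
apply: arith_ext => [v Dv|].
  by rewrite -gcd_digit; [reflexivity | apply: F_gt0 | apply: H_gt0].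
by repeat arith_step.
Qed.

Lemma arith_log2 F (L : k.-tuple nat -> nat) :
  arith F -> (forall v, D v -> F v = 2 ^ L v) -> arith L.
Proof.
move=> aF F_pow.
apply: (@arith_ext _ _ _ (fun v => F v ^ (F v + 1)
     %% (2 ^ (F v + 1) - 1) ^ 2 %/ (2 ^ (F v + 1) - 1))).
  by move=> v Dv; rewrite F_pow // addn1 log_pow2.
by repeat arith_step.
Qed.

Lemma arith_hw F : arith F -> arith (fun v => hw (F v)).
Proof.
move=> aF; pose C v := 'C(2 * F v, F v).
have C_gt0 v : 0 < C v by rewrite bin_gt0 leq_pmull.
have aC : arith C by apply: arith_bin; repeat arith_step.
apply: (@arith_log2 (fun v => gcdn (C v) (2 ^ C v))) => [|v _]; last first.
  by rewrite gcd_pow2 // hw_logn /C mul2n.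
by apply: arith_gcd => // [v _|]; rewrite ?expn_gt0 //; repeat arith_step.
Qed.

Lemma arith_G r q s : (forall v, D v -> 1 < q v) -> arith q -> arith s ->
  arith (fun v => G r (q v) (s v)).
Proof.
move=> q_gt1 aq arith_s; elim/ltn_ind: r => r IH.
apply: arith_ext => [v Dv|]; first exact: G_closed (q_gt1 v Dv).
have asum := @arith_sum _ D r (fun i v => 'C(r, i) * G i (q v) (s v)).
apply: arith_div; last by repeat arith_step.
apply: arith_sub.
  by repeat arith_step; apply: arith_succ.
apply: arith_add; last by repeat arith_step.
apply: arith_mul => //; apply: asum => i ltir.
by apply: arith_mul; [apply: arith_cst | apply: IH].
Qed.

End ArithFunctions.

(** * The digits of M and their Hamming weight *)

Section Digits.
Variables m n : nat.
Hypotheses (m_gt1 : 1 < m) (n_gt0 : 0 < n).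
Let w := 2 * m * n.

(** The square of m^y + x - n: of the two truncated differences, one is zero and
    the other one is the absolute value. *)
Definition sqdev x y := ((m ^ y + x - n) + (n - (m ^ y + x))) ^ 2.

Lemma sqdev_eq0 x y : (sqdev x y == 0) = (m ^ y + x == n).
Proof. by rewrite /sqdev expn_eq0 andbT; lia. Qed.

Lemma sqdevE x y :
  sqdev x y + (2 * n * m ^ y + 2 * n * x)
    = n ^ 2 + 2 * (x * m ^ y) + (m ^ y) ^ 2 + x ^ 2.
Proof.
rewrite /sqdev; move: (m ^ y) => p.
have [/subnKC<-|/ltnW/subnKC def_px] := leqP (p + x) n.
  by move: (n - _) => d; rewrite subnDA subnn sub0n addKn; ring.
have -> : n - (p + x) = 0 by lia.
rewrite addn0; set d := p + x - n in def_px *.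
have -> : x ^ 2 = x * x by [].
by nia.
Qed.

Lemma sqdev_le x y : x <= n -> y <= n -> sqdev x y <= 2 ^ w.
Proof.
move=> le_xn le_yn; rewrite /w.
have le_p : m ^ y <= m ^ n by rewrite leq_exp2l.
have lt_n : n < m ^ n by apply: ltn_expl.
apply: leq_trans (_ : _ <= (m ^ n) ^ 2) _; first by rewrite leq_exp2r //; lia.
rewrite -expnM mulnC -mulnA mulnCA mulnC [2 ^ _]expnM.
by rewrite leq_exp2r ?muln_gt0 ?n_gt0 // ltnW // ltn_expl.
Qed.

(** This definition truncates no difference when x, y <= n, by [sqdev_le]. *)
Definition block x y := (2 ^ w - 1) * (2 ^ w + 1 - sqdev x y).
Definition blocksum := \sum_(y < n.+1)
  (\sum_(x < n.+1) block x y * 2 ^ (2 * w * x)) * 2 ^ (2 * w * n.+1 * y).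

(** A zero of [sqdev] gives the word (2^w - 1)(2^w + 1) = 2^(2w) - 1, which has
    twice as many ones as any other digit. *)
Lemma hw_block x y : x <= n -> y <= n ->
  hw (block x y) = w * (1 + (m ^ y + x == n)).
Proof.
move=> le_xn le_yn; have f_le := sqdev_le le_xn le_yn.
rewrite -sqdev_eq0 /block; have [f0|f_neq0] := eqVneq (sqdev x y) 0.
  by rewrite f0 subn0 -[X in _ + X]/(1) -subn_sqr exp1n -expnM hw_mersenne.
by rewrite hw_mul_mersenne ?muln1 //; lia.
Qed.

Lemma block_lt x y : block x y < 2 ^ (2 * w).
Proof.
have := expn_gt0 2 w; rewrite [2 * w]mulnC expnM /block.
move: (2 ^ w) => W W_gt0.
apply: leq_ltn_trans (_ : _ <= (W - 1) * (W + 1)) _.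
  by rewrite leq_mul2l leq_subr orbT.
by rewrite -subn_sqr exp1n subn1 prednK // expn_gt0 W_gt0.
Qed.

Lemma count_lt k K : \sum_(i < K) (i < k) = minn k K.
Proof.
elim: K => [|K IH]; first by rewrite big_ord0 minn0.
by rewrite big_ord_recr /= IH; lia.
Qed.

(** For each y at most one x solves m^y + x = n, and it lies in the range iff
    m^y <= n, which means that y is at most the logarithm. *)
Lemma count_powers :
  \sum_(y < n.+1) \sum_(x < n.+1) (m ^ y + x == n)
    = (trunc_log m n).+1.
Proof.
have log_le : trunc_log m n <= n.
  apply: leq_trans (trunc_logP m_gt1 n_gt0); exact/ltnW/ltn_expl.
have /minn_idPl <- : (trunc_log m n).+1 <= n.+1 by [].
rewrite -count_lt; apply: eq_bigr => y _.
have -> : (y < (trunc_log m n).+1) = (m ^ y <= n).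
  rewrite ltnS; apply/idP/idP => [le_y|/(trunc_log_max m_gt1) //].
  by apply: leq_trans (trunc_logP m_gt1 n_gt0); rewrite leq_exp2l.
have [le_yn|lt_ny] := leqP (m ^ y) n; last first.
  by rewrite big1 // => x _; case: eqP => //; lia.
have lt_x : n - m ^ y < n.+1 by rewrite ltnS leq_subr.
rewrite (bigD1 (Ordinal lt_x)) //= subnKC // eqxx big1 // => x.
by rewrite -(inj_eq val_inj) /=; case: eqP => //; lia.
Qed.

Lemma hw_blocksum :
  hw blocksum = w * (n.+1 ^ 2 + (trunc_log m n).+1).
Proof.
have row_lt y :
    \sum_(x < n.+1) block x y * 2 ^ (2 * w * x) < 2 ^ (2 * w * n.+1).
  by apply: (@numeral_lt _ _ (block^~ y)) => x _; apply: block_lt.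
rewrite /blocksum.
rewrite (@hw_numeral _ _ (fun y => \sum_(x < n.+1) block x y * 2 ^ (2 * w * x))) //.
rewrite -count_powers mulnDr big_distrr /=.
have -> : w * n.+1 ^ 2 = \sum_(y < n.+1) \sum_(x < n.+1) w.
  by rewrite !(sum_nat_const, card_ord); ring.
rewrite -big_split /=; apply: eq_bigr => y _.
rewrite (@hw_numeral _ _ (block^~ y)); last by move=> x _; apply: block_lt.
rewrite big_distrr -big_split /=; apply: eq_bigr => x _.
by rewrite hw_block ?mulnDr ?muln1 // -ltnS.
Qed.

(** * The value of M *)

Definition Gx r := G r (2 ^ (2 * w)) n.
Definition Gy b := G 0 (2 ^ (2 * w * n.+1) * m ^ b) n.

(** M = Mpos - Mneg.  With the negative contributions collected in one place, a
    single truncated subtraction computes M. *)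
Definition Mpos := (2 ^ w - 1) *
  ((2 ^ w + 1) * (Gx 0 * Gy 0) + 2 * n * (Gx 0 * Gy 1) + 2 * n * (Gx 1 * Gy 0)).
Definition Mneg := (2 ^ w - 1) *
  (n ^ 2 * (Gx 0 * Gy 0) + 2 * (Gx 1 * Gy 1) + Gx 0 * Gy 2 + Gx 2 * Gy 0).

Lemma GxGyE r b : Gx r * Gy b =
  \sum_(y < n.+1) \sum_(x < n.+1)
     x ^ r * (m ^ y) ^ b * (2 ^ (2 * w * x) * 2 ^ (2 * w * n.+1 * y)).
Proof.
rewrite /Gx /Gy /G !big_mkord mulnC big_distrlr /=.
apply: eq_bigr => y _; apply: eq_bigr => x _.
by rewrite mul1n expnMn -!expnM [b * y]mulnC; ring.
Qed.

(** The products of sums are expanded into double sums, which agree term by term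
    because of [sqdevE]. *)
Lemma blocksumE : blocksum + Mneg = Mpos.
Proof.
rewrite /Mpos /Mneg !GxGyE !(big_distrr, =^~ big_split) /= /blocksum.
apply: eq_bigr => y _.
rewrite !(big_distrl, big_distrr, =^~ big_split) /=; apply: eq_bigr => x _.
have f_le := sqdev_le (ltnSE (ltn_ord x)) (ltnSE (ltn_ord y)).
have fE := sqdevE x y; rewrite /block.
have [g gE] : exists g, 2 ^ w + 1 = sqdev x y + g.
  by exists (2 ^ w + 1 - sqdev x y); rewrite subnKC // addn1 leqW.
rewrite gE addKn.
move: fE; move: (sqdev x y) (m ^ y) (2 ^ w - 1) => f p W fE.
move: (2 ^ (2 * w * x)) (2 ^ (2 * w * n.+1 * y)) => u v.
transitivity (W * (g + (n ^ 2 + 2 * (x * p) + p ^ 2 + x ^ 2)) * (u * v)).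
  by ring.
by rewrite -fE; ring.
Qed.

End Digits.

(** The term is the one of the theorem: [hw_blocksum] solved for the logarithm,
    with truncated operations that are exact here. *)
Lemma arith_trunc_log (D : pred (2.-tuple nat)) :
    (forall v, D v -> 1 < tnth v ord0 /\ 0 < tnth v ord_max) ->
  arith D (fun v => trunc_log (tnth v ord0) (tnth v ord_max)).
Proof.
move=> Dgt; pose m (v : 2.-tuple nat) := tnth v ord0.
pose n (v : 2.-tuple nat) := tnth v ord_max.
pose w v := 2 * m v * n v.
apply: (@arith_ext _ _ _ (fun v =>
    hw (Mpos (m v) (n v) - Mneg (m v) (n v)) %/ w v - (n v + 1) ^ 2 - 1)).
  move=> v /Dgt[m_gt1 n_gt0].
  rewrite -blocksumE // addnK hw_blocksum // mulKn ?muln_gt0 ?(ltnW m_gt1) //.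
  by rewrite addn1 addKn subn1.
have am : arith D m by apply: arith_var.
have an : arith D n by apply: arith_var.
have aw : arith D w by repeat arith_step.
have aX r : arith D (fun v => Gx (m v) (n v) r).
  apply: arith_G; [|by repeat arith_step..].
  move=> v /Dgt[m_gt1 n_gt0]; rewrite -[1]/(2 ^ 0) ltn_exp2l // !muln_gt0 /=.
  by rewrite n_gt0 (ltnW m_gt1).
have aY b : arith D (fun v => Gy (m v) (n v) b).
  apply: arith_G; [|by repeat (arith_step || apply: arith_succ)..].
  move=> v /Dgt[m_gt1 n_gt0]; have m_gt0 := ltnW m_gt1.
  apply: leq_trans (leq_pmulr _ _); last by rewrite expn_gt0 m_gt0.
  by rewrite -[1]/(2 ^ 0) ltn_exp2l // !muln_gt0 /= m_gt0 n_gt0.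
have apos : arith D (fun v => Mpos (m v) (n v)) by repeat arith_step; done.
have aneg : arith D (fun v => Mneg (m v) (n v)) by repeat arith_step; done.
have ahw := arith_hw (arith_sub apos aneg).
by repeat arith_step.
Qed.

Local Open Scope ring_scope.

Lemma MposnegE m n (W : rat := (2 ^ (2 * m * n))%N%:R) :
  (Mpos m n)%:R - (Mneg m n)%:R = (W - 1) *
    ((W + 1 - (n ^ 2)%N%:R) * ((Gx m n 0)%:R * (Gy m n 0)%:R)
     + (2 * n)%N%:R * ((Gx m n 0)%:R * (Gy m n 1)%:R)
     + (2 * n)%N%:R * ((Gx m n 1)%:R * (Gy m n 0)%:R)
     - 2%:R * ((Gx m n 1)%:R * (Gy m n 1)%:R)
     - (Gx m n 0)%:R * (Gy m n 2)%:R - (Gx m n 2)%:R * (Gy m n 0)%:R).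
Proof.
rewrite /Mpos /Mneg !(natrM, natrD, natrB) ?expn_gt0 // -/W.
by ring.
Qed.

Lemma calA2E t w c b1 b2 e1 e2 r1 r2 :
  calA t w (Monomial c [tuple b1; b2] [tuple e1; e2] [tuple r1; r2]) =
  - (2 ^+ w - 1) * c%:~R *
    ((G r1 (2 ^ (2 * w) * b1 ^ e1) t.-1)%:R *
     (G r2 (2 ^ (2 * w * t) * b2 ^ e2) t.-1)%:R).
Proof. by rewrite /calA !big_ord_recl big_ord0 mulr1 muln1 expn1. Qed.

(** The quotient by 2^w + 1 is exact: with Q = 2^(2w) and t = n + 1,
    Q^(t^2) - 1 = (Q - 1) (1 + Q + ... + Q^(t-1)) (1 + Q^t + ... + Q^(t(t-1))). *)
Lemma calC2E w eps n :
  calC n.+1 w eps 2 = (2 ^+ w - eps%:~R + 1) * (2 ^+ w - 1) *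
    ((G 0 (2 ^ (2 * w)) n)%:R * (G 0 (2 ^ (2 * w * n.+1)) n)%:R).
Proof.
have geomR k : ((2 ^ k) * G 0 (2 ^ k) n)%:R =
    (G 0 (2 ^ k) n)%:R + 2 ^+ (k * n.+1) - 1 :> rat.
  by rewrite -natrX expnM -natrD -G_geometric natrD addrK.
have gx := geomR (2 * w)%N; have gy := geomR (2 * w * n.+1)%N.
have W_neq : 2 ^+ w + 1 != 0 :> rat by rewrite lt0r_neq0 // ltr_wpDl ?exprn_ge0.
rewrite /calC -[RHS]mulrA; congr (_ * _).
rewrite -[(_ * n.+1 * n.+1)%N]mulnA mulnn in gy.
apply: (mulIf W_neq); rewrite mulfVK //.
have -> : 2 ^+ (2 * w * n.+1 ^ 2) - 1 =
    (2 ^+ (2 * w * n.+1) - 1) * (G 0 (2 ^ (2 * w * n.+1)) n)%:R :> rat.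
  by move: gy; rewrite natrM natrX mulrBl mul1r => ->; ring.
have -> : 2 ^+ (2 * w * n.+1) - 1 =
    (2 ^+ (2 * w) - 1) * (G 0 (2 ^ (2 * w)) n)%:R :> rat.
  by move: gx; rewrite natrM natrX mulrBl mul1r => ->; ring.
by rewrite mulnC exprM; ring.
Qed.

Lemma M_blocksum m n : (1 < m)%N -> (0 < n)%N -> M m n = (blocksum m n)%:R.
Proof.
move=> m_gt1 n_gt0.
have -> : (blocksum m n)%:R = (Mpos m n)%:R - (Mneg m n)%:R :> rat.
  by rewrite -(blocksumE m_gt1 n_gt0) natrD addrK.
rewrite MposnegE /M addn1 calC2E !calA2E /= natrX /Gx /Gy.
rewrite !exp1n !expn0 !expn1 !muln1 rmorphN /= -!pmulrn.
by ring.
Qed.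

Theorem theorem9p3 :
  exists tau : aterm 2, forall m n : nat, (2 <= m)%N -> (1 <= n)%N ->
  exists N : nat,
    [/\ N%:R = M m n,
        (aeval [tuple m; n] tau)%:R =
          (hw N)%:R / (2 * m * n)%:R - (n + 1)%:R ^+ 2 - 1 :> rat
      & (trunc_log m n)%:R =
          (hw N)%:R / (2 * m * n)%:R - (n + 1)%:R ^+ 2 - 1 :> rat].
Proof.
pose D (v : 2.-tuple nat) := (1 < tnth v ord0)%N && (0 < tnth v ord_max)%N.
have [tau tauE] : arith D (fun v => trunc_log (tnth v ord0) (tnth v ord_max)).
  by apply: arith_trunc_log => v /andP[].
exists tau => m n m_gt1 n_gt0; exists (blocksum m n).
have logE : (trunc_log m n)%:R = (hw (blocksum m n))%:R / (2 * m * n)%:R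
    - (n + 1)%:R ^+ 2 - 1 :> rat.
  have w_neq0 : (2 * m * n)%:R != 0 :> rat by rewrite pnatr_eq0; lia.
  rewrite hw_blocksum // mulnC natrM mulfK // addn1 -addn1 !natrD natrX.
  by ring.
split=> //; first by rewrite M_blocksum.
by rewrite tauE // /D m_gt1.
Qed.
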